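(* Let $G$ be a countable amenable group and let $X\subset \Sigma^G$ be a nonempty $G$-SFT. For every $\varepsilon > 0$ there exists a nonempty $G$-SFT $Z \subset X$ such that $h_{\mathrm{top}}(G \curvearrowright Z) \leq \varepsilon$.
   Context: For a countable group $G$ and a finite set $\Sigma$, $\Sigma^G$ carries the product topology and the left action $(gx)(h)=x(hg)$. A $G$-subshift is a closed $G$-invariant subset of $\Sigma^G$. A pattern is an element $p\in\Sigma^F$ with $F\subset G$ finite, and $[p]=\{x\in\Sigma^G: x|_F=p\}$. A subshift $X\subset\Sigma^G$ is of finite type ($G$-SFT) if there is a finite set $\mathcal{F}$ of patterns with $X=\Sigma^G\setminus\bigcup_{p\in\mathcal{F},g\in G}g[p]$. For finite $F\subset G$, $L_F(X)=\{x|_F : x\in X\}$. For $G$ countable amenable and $X$ a nonempty $G$-subshift, $h_{\mathrm{top}}(G\curvearrowright X)=\lim_{n}\frac{1}{|F_n|}\log|L_{F_n}(X)|$, where $(F_n)$ is any sequence of nonempty finite subsets of $G$ with $|KF_n\triangle F_n|/|F_n|\to 0$ for every finite $K\subset G$ (the limit exists and does not depend on the sequence).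
   Formalization: G is assumed infinite, since the claim fails for finite groups (G = Z/2, X = {01,10} has no proper nonempty sub-SFT and entropy (log 2)/2); in the condition on (F_n), K ranges over nonempty finite sets, as K empty would make the ratio 1. *)

(* Defs.v *)
From HB Require Import structures.
From mathcomp Require Import all_boot all_order all_algebra all_fingroup finmap.
From mathcomp Require Import all_classical all_reals all_analysis.

Set Implicit Arguments.
Unset Strict Implicit.
Unset Printing Implicit Defensive.

Import Order.TTheory GRing.Theory Num.Theory.
Import numFieldNormedType.Exports.

Local Open Scope classical_set_scope.
Local Open Scope ring_scope.

Notation config G Sigma :=
  (prod_topology (fun _ : G => discrete_topology Sigma)).

Section Subshifts.
Variables (G : groupType) (Sigma : finType).
Local Notation config := (config G Sigma).

Definition shift (g : G) (x : config) : config := fun h => x (h * g)%g.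

Definition is_subshift (X : set config) : Prop :=
  closed X /\ forall g, shift g @` X `<=` X.

Definition restrict_to (F : {fset G}) (x : config) : {ffun F -> Sigma} :=
  [ffun h => x (val h)].

(* A pattern is a finite map: its domain [domf p] is the finite set F. *)
Definition pattern : Type := {fmap G -> Sigma}.

Definition cylinder (p : pattern) : set config :=
  [set x | restrict_to (domf p) x = ffun_of_fmap p].

Definition is_SFT (X : set config) : Prop :=
  is_subshift X /\
  exists2 P : set pattern, finite_set P &
    X = ~` \bigcup_(p in P) \bigcup_(g in [set: G]) (shift g @` cylinder p).

Definition language (F : {fset G}) (X : set config) : set {ffun F -> Sigma} :=
  restrict_to F @` X.

End Subshifts.

Arguments language {G Sigma} F X _.

Definition setmul (G : groupType) (K F : {fset G}) : {fset G} :=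
  [fset (k * f)%g | k in K, f in F]%fset.

Definition symdiff (G : groupType) (A B : {fset G}) : {fset G} :=
  ((A `\` B) `|` (B `\` A))%fset.

(* K must be nonempty: for K = fset0 the ratio below is constantly 1. *)
Definition folner (R : realType) (G : groupType) (F : nat -> {fset G}) : Prop :=
  (forall n, F n != fset0) /\
  forall K : {fset G}, K != fset0 ->
    (fun n => #|` symdiff (setmul K (F n)) (F n)|%:R / #|` F n|%:R : R)
      @ \oo --> (0 : R).

Definition amenable (R : realType) (G : groupType) : Prop :=
  exists F : nat -> {fset G}, folner R F.

(* [is_htop X h]: the entropy limit exists along every Folner sequence and all
   these limits equal h.  For amenable G at most one h qualifies. *)
Definition is_htop (R : realType) (G : groupType) (Sigma : finType)
    (X : set (config G Sigma)) (h : R) : Prop :=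
  forall F : nat -> {fset G}, folner R F ->
    (fun n => ln (#|` fset_set (language (F n) X)|%:R : R) / #|` F n|%:R)
      @ \oo --> h.

(* Main.v *)
(** Two ideas carry the proof.

    Entropy is an infimum: by Shearer's inequality for the translates [K g],
    which cover each point of [F] exactly [#|K|] times,
    [#|K| * ln N(F) <= #|K^-1 F| * ln N(K)], where [N(F)] counts the patterns on
    [F].  Hence the limit exists along every Folner sequence and equals the
    infimum of [ln N(K) / #|K|].  So it suffices to find one point [y] of [X] whose
    orbit shows at most [exp (eps * #|K|)] patterns on one finite [K]: the points
    of [X] showing only these patterns on [K] form an SFT of entropy at most [eps].

    Such a [y] comes from a greedy tiling with a single shape [T], large and
    almost invariant.  In stage [j], choose a maximal separated family of centers
    [g] for which a proportion at least [delta] of [T g] is not yet covered; the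
    center owns these points.  After finitely many stages every translate [T g]
    is covered up to a proportion [delta].  Centers have density at most
    [1 / (delta * #|T|)], which tends to [0] because [G] is infinite, and the
    points that are uncovered or close to the edge of their tile (the gap) have
    density [O(delta)].  Starting from any point of [X], rewrite the rest of each
    tile by a filling chosen as a function of the surrounding gap symbols only:
    the result [y] is again in [X], and [y] is locally determined by the levels of
    the centers and by its restriction to the gap, two sparse data. *)
Require Import Defs.
From mathcomp Require Import all_boot all_order all_algebra all_fingroup finmap.
From mathcomp Require Import all_classical all_reals all_analysis.
From mathcomp Require Import lra ring.

Set Implicit Arguments.
Unset Strict Implicit.
Unset Printing Implicit Defensive.

Import Order.TTheory GRing.Theory Num.Theory.
Import numFieldNormedType.Exports.

Local Open Scope classical_set_scope.
Local Open Scope ring_scope.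

(** * Shearer's inequality for pattern counts *)

(** Hölder's inequality with [#|J|] equal exponents. After each [x i] is divided by its sum, AM-GM
    gives [n a <= q * mu a], where [mu] has total mass 1. *)
Lemma holder_prod (R : realType) (A I : finType) (J : {set I}) (P : R)
    (n : A -> R) (x : I -> A -> R) :
  (0 < #|J|)%N -> 0 <= P -> (forall a, 0 <= n a) -> (forall i a, 0 <= x i a) ->
  (forall a, n a ^+ #|J| <= P * \prod_(i in J) x i a) ->
  (\sum_a n a) ^+ #|J| <= P * \prod_(i in J) \sum_a x i a.
Proof.
move=> J0 P0 n0 x0 nx; set k := #|J| in J0 nx *.
have X0 i : 0 <= \sum_a x i a by rewrite sumr_ge0.
have Q0 : 0 <= P * \prod_(i in J) \sum_a x i a by rewrite mulr_ge0 ?prodr_ge0.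
have [/existsP[i /andP[iJ /eqP Xi0]]|/existsPn XJ] :=
    boolP [exists i, (i \in J) && (\sum_a x i a == 0)].
  rewrite big1 ?expr0n ?gtn_eqF // => a _.
  have xia0 : x i a = 0 by apply: psumr_eq0P Xi0 _ _.
  apply/eqP; have := nx a.
  rewrite (bigD1 i) //= xia0 mul0r mulr0 => nxa.
  have : n a ^+ k == 0 by rewrite eq_le nxa exprn_ge0.
  by rewrite expf_eq0 J0.
have Xn0 i : i \in J -> \sum_a x i a != 0.
  by move=> iJ; have := XJ i; rewrite iJ.
set Q := P * _ in Q0 *; pose q := Q `^ (k%:R^-1).
have q0 : 0 <= q by apply: powR_ge0.
have kR0 : k%:R != 0 :> R by rewrite pnatr_eq0 -lt0n.
have qk : q ^+ k = Q.
  by rewrite -powR_mulrn ?powR_ge0// /q -powRrM mulVf// powRr1.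
pose mu a := (\sum_(i in J) x i a / \sum_b x i b) / k%:R.
have mu0 a : 0 <= mu a.
  by rewrite divr_ge0 ?sumr_ge0// => i _; rewrite divr_ge0.
have pw (u v : R) : 0 <= u -> 0 <= v -> (u ^+ k <= v ^+ k) = (u <= v).
  by move=> u0 v0; apply: ler_pXn2r => //; rewrite nnegrE.
have nq a : n a <= q * mu a.
  rewrite -pw ?(mulr_ge0 q0 (mu0 a))// exprMn qk.
  apply: le_trans (nx a) _.
  have -> : P * \prod_(i in J) x i a
      = Q * \prod_(i in J) (x i a / \sum_b x i b).
    rewrite /Q -mulrA; congr (_ * _); rewrite -big_split /=.
    by apply: eq_bigr => i iJ; rewrite mulrC divfK// Xn0.
  rewrite ler_wpM2l//.
  by have /leif_AGM[] : {in J, forall i, 0 <= x i a / \sum_b x i b}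
    by move=> i _; rewrite divr_ge0.
rewrite -qk pw ?sumr_ge0//.
apply: (le_trans (ler_sum _ (fun a _ => nq a))).
rewrite -mulr_sumr -[leRHS]mulr1 ler_wpM2l//.
rewrite -mulr_suml exchange_big /= ler_pdivrMr ?mul1r ?ltr0n//.
rewrite (eq_bigr (fun=> 1)) ?sumr_const// => i iJ.
by rewrite -mulr_suml divff// Xn0.
Qed.

Section PatternCount.
Variables (G : choiceType) (Sigma : finType).
Implicit Types (F : {fset G}) (Z : set (G -> Sigma)) (z : G -> Sigma).

(** [language] as a [{set _}], so that finite cardinals and big operators apply. *)
Definition patterns F Z : {set {ffun F -> Sigma}} :=
  [set p | `[< exists2 z, Z z & [ffun h : F => z (val h)] = p >]].

Lemma patternsP F Z p :
  reflect (exists2 z, Z z & [ffun h : F => z (val h)] = p) (p \in patterns F Z).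
Proof. by rewrite inE; apply: asboolP. Qed.

(** [d] is a code from which [z] on [F] can be read back; [code] decodes by choice, so its image of
    [E] contains every pattern. *)
Lemma card_patterns_le (D : finType) (E : {set D}) F Z (d : (G -> Sigma) -> D) :
  (forall z, Z z -> d z \in E) ->
  (forall z1 z2, Z z1 -> Z z2 -> d z1 = d z2 -> {in F, z1 =1 z2}) ->
  (#|patterns F Z| <= #|E|)%N.
Proof.
move=> dE dinj.
pose code e := [pick p : {ffun F -> Sigma} |
  `[< exists2 z, Z z /\ d z = e & [ffun h : F => z (val h)] = p >]].
rewrite -(card_imset (mem (patterns F Z)) (@Some_inj _)).
apply: leq_trans (leq_imset_card code (mem E)).
apply: subset_leq_card; apply/fintype.subsetP => _ /imsetP[p /patternsP[z Zz zp] ->].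
apply/imsetP; exists (d z); first exact: dE.
rewrite /code; case: pickP => [q /asboolP[z' [Zz' dz'] zq]|/(_ p)/asboolP[]].
  rewrite -zp -zq; congr (Some _); apply/ffunP => h; rewrite !ffunE.
  by apply: (dinj z z') => //; apply: valP.
by exists z.
Qed.

Lemma card_patterns_mono F1 F2 Z1 Z2 :
  {subset F1 <= F2} -> Z1 `<=` Z2 -> (#|patterns F1 Z1| <= #|patterns F2 Z2|)%N.
Proof.
move=> F12 Z12; apply: (@card_patterns_le _ _ _ _
  (fun z => [ffun h : F2 => z (val h)])) => [z Zz|z1 z2 _ _ zz f fF1].
  by apply/patternsP; exists z => //; apply: Z12.
by move/ffunP: zz => /(_ [` F12 _ fF1]%fset); rewrite !ffunE.
Qed.

Lemma card_patterns_gt0 F Z : Z !=set0 -> (0 < #|patterns F Z|)%N.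
Proof.
by move=> [z Zz]; apply/card_gt0P; eexists; apply/patternsP; exists z.
Qed.

Lemma card_patterns_split F Z f : f \in F ->
  #|patterns F Z| = (\sum_a #|patterns F (Z `&` [set z | z f = a])|)%N.
Proof.
move=> fF; rewrite -sum1_card (partition_big (fun p : {ffun F -> Sigma} => p [` fF]%fset) predT)//=.
apply: eq_bigr => a _; rewrite -sum1_card; apply: eq_bigl => p.
apply/andP/patternsP => [[/patternsP[z Zz <-] /eqP za]|[z [Zz za] <-]].
  by exists z => //; split=> //=; rewrite -za ffunE.
by split; [apply/patternsP; exists z|rewrite ffunE /= za].
Qed.

(** Induction on [F], conditioning on the symbol at a point [f]: the factors of [k] sets through [f]
    split over that symbol, the others are bounded by their unconditional values, and [holder_prod]
    sums up. *)
Lemma shearer (R : realType) (I : finType) (A : I -> {fset G}) (k : nat) F Z :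
  (0 < k)%N -> (forall f, f \in F -> (k <= #|[set i | f \in A i]|)%N) ->
  (#|patterns F Z|%:R : R) ^+ k <= \prod_i #|patterns (A i) Z|%:R.
Proof.
move=> k0; have [m] := ubnP #|` F|; elim: m F Z => // m IH F Z.
have [Z0 _ _|/set0P Zn0] := eqVneq Z set0.
  rewrite (_ : #|_| = 0%N) ?expr0n ?gtn_eqF ?prodr_ge0//.
  by apply: eq_card0 => p; apply/negP => /patternsP[z]; rewrite Z0.
have [->|[f fF]] := fset_0Vmem F.
  move=> _ _; rewrite [X in X%:R ^+ _](_ : _ = 1%N) ?expr1n.
    rewrite -natr_prod ler1n prodn_gt0// => i; exact: card_patterns_gt0.
  apply/eqP; rewrite eqn_leq card_patterns_gt0// andbT.
  apply: leq_trans (max_card _) _.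
  by rewrite card_ffun -cardfE cardfs0 expn0.
rewrite (cardfsD1 f) fF ltnS => Fm cov.
(* The exponent in [holder_prod] is the number of split factors, so exactly [k] of the sets through
   [f] are kept. *)
have [J [Jcov Jk]] : exists J : {set I}, J \subset [set i | f \in A i] /\ #|J| = k.
  have /card_geqP[s [us <- sA]] := cov _ fF.
  exists [set i in s]; split; last by rewrite cardsE; apply/card_uniqP.
  by apply/fintype.subsetP => i; rewrite inE => /sA.
(* Once the symbol at [f] is fixed, this coordinate carries no information. *)
have nE a : #|patterns F (Z `&` [set z | z f = a])|
    = #|patterns (F `\ f)%fset (Z `&` [set z | z f = a])|.
  apply/eqP; rewrite eqn_leq; apply/andP; split; last first.
    by apply: card_patterns_mono => // h /fsetD1P[].
  apply: (@card_patterns_le _ _ _ _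
      (fun z => [ffun h : (F `\ f)%fset => z (val h)])) => [z Zz|].
    by apply/patternsP; exists z.
  move=> z1 z2 [_ /= z1a] [_ /= z2a] zz h hF.
  have [->|hf] := eqVneq h f; first by rewrite z1a z2a.
  have hF' : h \in (F `\ f)%fset by rewrite in_fsetD1 hf.
  by move/ffunP: zz => /(_ [` hF']%fset); rewrite !ffunE.
pose P : R := \prod_(i in ~: J) #|patterns (A i) Z|%:R.
pose x i a : R := #|patterns (A i) (Z `&` [set z | z f = a])|%:R.
rewrite (bigID (fun i => i \in J)) /= mulrC.
rewrite (eq_bigl (fun i => i \in ~: J)) => [|i]; last by rewrite inE.
rewrite (card_patterns_split Z fF) natr_sum -{1}Jk.
rewrite [X in _ <= _ * X](eq_bigr (fun i => \sum_a x i a)); last first.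
  move=> i iJ; rewrite -natr_sum -card_patterns_split//.
  by have := fintype.subsetP Jcov _ iJ; rewrite inE.
apply: holder_prod => //.
- by rewrite Jk.
- by rewrite prodr_ge0.
move=> a; rewrite Jk nE.
apply: le_trans (IH _ _ Fm _) _ => [g /fsetD1P[_ gF]|]; first exact: cov.
rewrite (bigID (fun i => i \in J)) /= mulrC ler_wpM2r ?prodr_ge0//.
rewrite [leLHS](eq_bigl (fun i => i \in ~: J)) => [|i]; last by rewrite inE.
apply: ler_prod => i _; rewrite ler0n ler_nat /=.
by apply: card_patterns_mono => // z [].
Qed.
End PatternCount.

(** * The infimum rule for topological entropy *)

Lemma card_fset_set (T : finType) (A : set T) :
  #|` fset_set A| = #|[set x | `[< A x >]]%SET|.
Proof.
rewrite cardE; apply: perm_size; apply: uniq_perm.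
- exact: fset_uniq.
- exact: enum_uniq.
move=> x; rewrite mem_enum. rewrite [RHS]inE in_fset_set; last exact: finite_finset.
by apply/idP/asboolP => [/set_mem|/mem_set].
Qed.

Lemma card_language (G : groupType) (Sigma : finType) (F : {fset G})
    (X : set (config G Sigma)) :
  #|` fset_set (language F X)| = #|patterns F X|.
Proof. by rewrite card_fset_set. Qed.

Definition fsetinv (G : groupType) (K : {fset G}) : {fset G} :=
  [fset k^-1%g | k in K]%fset.

Lemma mem_setmul (G : groupType) (K F : {fset G}) k f :
  k \in K -> f \in F -> (k * f)%g \in setmul K F.
Proof. by move=> kK fF; apply: in_imfset2. Qed.

Lemma setmulP (G : groupType) (K F : {fset G}) g :
  reflect (exists k f, [/\ k \in K, f \in F & g = (k * f)%g]) (g \in setmul K F).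
Proof.
apply: (iffP idP) => [/imfset2P[k kK [f fF ->]]|[k [f [kK fF ->]]]].
  by exists k, f.
exact: mem_setmul.
Qed.

Lemma mem_fsetinv (G : groupType) (K : {fset G}) k :
  (k \in fsetinv K) = (k^-1%g \in K).
Proof.
apply/imfsetP/idP => [[l lK ->]|kK]; first by rewrite invgK.
by exists k^-1%g => //; rewrite invgK.
Qed.

Lemma card_fsetinv (G : groupType) (K : {fset G}) : #|` fsetinv K| = #|` K|.
Proof. by rewrite card_imfset//; apply: invg_inj. Qed.

Lemma card_setmul1r (G : groupType) (K : {fset G}) g :
  #|` setmul K [fset g]%fset| = #|` K|.
Proof.
rewrite (_ : setmul K _ = [fset (k * g)%g | k in K]%fset).
  by rewrite card_imfset//; apply: mulIg.
apply/fsetP => h; apply/setmulP/imfsetP.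
  by move=> [k [f [kK /fset1P -> ->]]]; exists k.
by move=> [k kK ->]; exists k, g; rewrite inE eqxx.
Qed.

Lemma card_setmul_le (G : groupType) (K F : {fset G}) :
  (#|` setmul K F| <= #|` F| + #|` symdiff (setmul K F) F|)%N.
Proof.
have sub : (setmul K F `<=` F `|` symdiff (setmul K F) F)%fset.
  apply/fsubsetP => g gKF; rewrite !inE gKF andbT.
  by case: (g \in F).
apply: leq_trans (fsubset_leq_card sub) _.
by rewrite cardfsU leq_subr.
Qed.

Section InfimumRule.
Variables (R : realType) (G : groupType) (Sigma : finType).
Variable (Z : set (config G Sigma)).
Hypothesis Zshift : forall g, Defs.shift g @` Z `<=` Z.
Hypothesis Z0 : Z !=set0.

Lemma card_patterns_translate (K : {fset G}) g :
  (#|patterns (setmul K [fset g]%fset) Z| <= #|patterns K Z|)%N.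
Proof.
apply: (@card_patterns_le _ _ _ _ _ _
  (fun z : config G Sigma => [ffun h : K => Defs.shift g z (val h)])) => [z Zz|].
  by apply/patternsP; exists (Defs.shift g z) => //; apply: Zshift; exists z.
move=> z1 z2 _ _ zz h /setmulP[k [f [kK /fset1P -> ->]]].
by move/ffunP: zz => /(_ [` kK]%fset); rewrite !ffunE.
Qed.

Let entropy (F : {fset G}) : R := ln #|patterns F Z|%:R.

Let entropy_ge0 F : 0 <= entropy F.
Proof. by rewrite ln_ge0// ler1n card_patterns_gt0. Qed.

Lemma shearer_translates (K F : {fset G}) : K != fset0 ->
  #|` K|%:R * entropy F <= #|` setmul (fsetinv K) F|%:R * entropy K.
Proof.
move=> K0; set S := setmul _ F.
have k0 : (0 < #|` K|)%N by rewrite cardfs_gt0.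
have cov f : f \in F ->
    (#|` K| <= #|[set i : S | f \in setmul K [fset val i]%fset]|)%N.
  (* Each [k] in [K] gives one translate through [f], the one based at [k^-1 * f]. *)
  move=> fF; have kfS k : k \in K -> (k^-1 * f)%g \in S.
    by move=> kK; apply: mem_setmul => //; rewrite mem_fsetinv invgK.
  pose e (k : K) : S := [` kfS _ (valP k)]%fset.
  have e_inj : injective e.
    by move=> k1 k2 /(congr1 val)/= /mulIg/invg_inj/val_inj.
  rewrite cardfE -(card_imset predT e_inj) subset_leq_card//.
  apply/fintype.subsetP => _ /imsetP[k _ ->]; rewrite inE /=.
  apply/setmulP; exists (fsval k), ((fsval k)^-1 * f)%g.
  by split; [apply: fsvalP|rewrite inE|rewrite mulVKg].
have := shearer R Z k0 cov.
move=> /(@le_trans _ _ _ _ (#|patterns K Z|%:R ^+ #|` S|)) H.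
rewrite /entropy ![_%:R * _]mulr_natl -!lnXn ?ltr0n ?card_patterns_gt0//.
rewrite ler_ln ?posrE ?exprn_gt0 ?ltr0n ?card_patterns_gt0//.
apply: H; rewrite cardfE -prodr_const; apply: ler_prod => i _.
by rewrite ler0n ler_nat card_patterns_translate.
Qed.

(** The limit is [inf B]. For [L] with ratio [b] close to it, Shearer and the Folner ratio [r] of
    [L^-1] bound the ratio at [F n] by [(1 + r) * b]. *)
Lemma infimum_rule (K : {fset G}) : K != fset0 ->
  exists2 h : R, is_htop Z h & h <= entropy K / #|` K|%:R.
Proof.
pose B : set R := [set b | exists2 K : {fset G}, K != fset0 &
  b = entropy K / #|` K|%:R].
have Blb : lbound B 0.
  by move=> _ [L _ ->]; rewrite divr_ge0.
move=> K0; have Bn0 : B !=set0 by exists (entropy K / #|` K|%:R), K.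
have hB : has_inf B by split=> //; exists 0.
exists (inf B); last first.
  by apply: ge_inf; [exists 0|exists K].
move=> F [Fn0 Fcvg].
under eq_fun do rewrite card_language.
apply/cvgrPdist_le => e e0.
have e20 : 0 < e / 2 by rewrite divr_gt0.
have [_ [L Ln0 ->] Lh] := inf_adherent e20 hB.
set b := entropy L / _ in Lh; have b0 : 0 <= b by rewrite divr_ge0.
have iL0 : fsetinv L != fset0.
  by rewrite -cardfs_gt0 card_fsetinv cardfs_gt0.
(* This tolerance gives [r * b <= e / 2]; the [+ 1] covers the case [b = 0]. *)
have /cvgrPdist_le/(_ (e / 2 / (b + 1))) := Fcvg _ iL0.
have eb0 : 0 < e / 2 / (b + 1) by rewrite divr_gt0// ltr_wpDl.
move=> /(_ eb0); apply: filterS => n.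
set r := _ / _; rewrite sub0r normrN ger0_norm ?divr_ge0// => re.
have Fpos : 0 < #|` F n|%:R :> R by rewrite ltr0n cardfs_gt0.
have Lpos : 0 < #|` L|%:R :> R by rewrite ltr0n cardfs_gt0.
have lo : inf B <= entropy (F n) / #|` F n|%:R.
  by apply: ge_inf; [exists 0|exists (F n)].
have up : entropy (F n) / #|` F n|%:R <= (1 + r) * b.
  rewrite ler_pdivrMr// -(ler_pM2l Lpos).
  apply: le_trans (shearer_translates _ Ln0) _.
  rewrite (_ : _ * (_ * _) = (#|` F n|%:R + r * #|` F n|%:R) * entropy L).
    rewrite ler_wpM2r// divfK ?gt_eqF// -natrD ler_nat.
    exact: card_setmul_le.
  by rewrite /b; field; rewrite gt_eqF.
rewrite distrC ger0_norm ?subr_ge0//.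
have : r * b <= e / 2.
  apply: le_trans (ler_wpM2r b0 re) _.
  rewrite mulrAC ler_pdivrMr ?ltr_wpDl// ler_wpM2l ?ltW//.
  by rewrite ltrDl.
rewrite mulrDl mul1r in up.
move=> rb; rewrite -/(entropy (F n)) lerBlDr.
apply: le_trans up _; apply: le_trans (lerD (ltW Lh) rb) _.
by rewrite -addrA -splitr addrC.
Qed.
End InfimumRule.

(** * Counting sparse functions *)

Section SmallSupport.
Variables (R : realType) (D L : finType).

Definition small_support (N : nat) : {set {ffun D -> option L}} :=
  [set f : {ffun D -> option L} | (#|[set d | f d != None]%SET| <= N)%N]%SET.

(* Chernoff-style weighting: each supported point costs a factor [z]. *)
Lemma card_small_support (N : nat) (z : R) : 1 <= z ->
  ln #|small_support N|%:R <= N%:R * ln z + #|D|%:R * (#|L|%:R / z).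
Proof.
move=> z1; have z0 : 0 < z by apply: lt_le_trans z1.
have lz0 : 0 <= #|L|%:R / z by rewrite divr_ge0// ltW.
pose w (o : option L) : R := if o is Some _ then z^-1 else 1.
have w0 o : 0 <= w o by case: o => [?|] //=; rewrite invr_ge0 ltW.
have wsum : \sum_o w o = 1 + #|L|%:R / z.
  rewrite (bigD1 None)//=; congr (_ + _).
  rewrite (eq_bigr (fun=> z^-1)) => [|[]//].
  rewrite sumr_const -[LHS]mulr_natl; congr (_%:R * _).
  have SI : injective (@Some L) by move=> ? ? [].
  rewrite -(card_imset predT SI); apply: eq_card => -[l|].
    by rewrite unfold_in; apply/esym/imsetP; exists l.
  by rewrite unfold_in; apply/esym/negbTE/imsetP => -[].
have prodw f : f \in small_support N -> 1 <= z ^+ N * \prod_d w (f d).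
  rewrite inE; set A := [set d | _]%SET => fN.
  rewrite (bigID (mem A)) /= [X in _ * (_ * X)]big1 ?mulr1; last first.
    by move=> d; rewrite inE negbK => /eqP ->.
  rewrite (eq_bigr (fun=> z^-1)) => [|d]; last by rewrite inE; case: (f d).
  rewrite prodr_const; move: #|A| fN => k kN.
  by rewrite exprVn ler_pdivlMr ?exprn_gt0// mul1r ler_weXn2l.
(* The product weights of all functions sum to [(\sum_o w o) ^+ #|D|], and each member of
   [small_support N] weighs at least [z ^- N]. *)
have card_le : #|small_support N|%:R <= z ^+ N * (1 + #|L|%:R / z) ^+ #|D|.
  rewrite -sum1_card natr_sum -wsum -prodr_const bigA_distr_bigA mulr_sumr /=.
  rewrite [leRHS](bigID (mem (small_support N))) /= ler_wpDr ?ler_sum//.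
  rewrite sumr_ge0// => f _.
  by rewrite mulr_ge0 ?exprn_ge0 ?prodr_ge0// ltW.
have s0 : 0 < #|small_support N|%:R :> R.
  rewrite ltr0n; apply/card_gt0P; exists [ffun=> None]; rewrite inE.
  by rewrite eq_card0// => d; rewrite inE ffunE eqxx.
have p1 : 0 < 1 + #|L|%:R / z by rewrite ltr_pwDl.
apply: (@le_trans _ _ (ln (z ^+ N * (1 + #|L|%:R / z) ^+ #|D|))).
  by rewrite ler_ln// posrE// mulr_gt0 ?exprn_gt0.
rewrite lnM ?posrE ?exprn_gt0// !lnXn// -[ln z *+ N]mulr_natl -[ln _ *+ _]mulr_natl lerD2l.
by rewrite ler_wpM2l// le_ln1Dx// (lt_le_trans _ lz0)// ltrN10.
Qed.
End SmallSupport.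

Lemma leq_card_fset (A B : choiceType) (f : A -> B) (S : {fset A}) (T : {fset B}) :
  {in S &, injective f} -> (forall x, x \in S -> f x \in T) ->
  (#|` S| <= #|` T|)%N.
Proof.
move=> f_inj fT; rewrite -(size_map f); apply: uniq_leq_size.
  by rewrite map_inj_in_uniq// fset_uniq.
by move=> _ /mapP[x xS ->]; apply: fT.
Qed.

Lemma card_fset_sum (A : choiceType) (S : {fset A}) (p : pred A) :
  #|` [fset a in S | p a]%fset| = (\sum_(a <- S) p a)%N.
Proof.
rewrite card_fset_sum1 -big_fset_condE big_mkcond /=.
by apply: eq_bigr => a _; case: (p a).
Qed.

Lemma double_count (A B : choiceType) (S : {fset A}) (T : {fset B})
    (r : A -> B -> bool) :
  (\sum_(a <- S) #|` [fset b in T | r a b]%fset| =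
   \sum_(b <- T) #|` [fset a in S | r a b]%fset|)%N.
Proof.
under eq_bigr do rewrite card_fset_sum.
by rewrite exchange_big /=; apply: eq_bigr => b _; rewrite card_fset_sum.
Qed.

(** * Greedy tilings with one shape *)

Section Tiling.
Variables (R : realType) (G : groupType) (T : {fset G}) (delta : R).
Hypotheses (T0 : T != fset0) (delta0 : 0 < delta).

(** The translate with center [c] is [T c]; left multiplication by a window then acts on it as on
    [T]. *)
Definition covers (c a : G) : bool := (a * c^-1)%g \in T.

Definition meets (c d : G) : Prop := exists2 a, covers c a & covers d a.

Definition translate_count (P : set G) (g : G) : nat :=
  #|` [fset t in T | `[< P (t * g)%g >]]%fset|.

Definition dense_in (P : set G) : set G :=
  [set g | delta * #|` T|%:R <= (translate_count P g)%:R].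

Lemma covers_mul t c : covers c (t * c)%g = (t \in T).
Proof. by rewrite /covers mulgK. Qed.

Lemma translate_count_mono (P Q : set G) g :
  P `<=` Q -> (translate_count P g <= translate_count Q g)%N.
Proof.
move=> PQ; apply: fsubset_leq_card; apply/fsubsetP => t.
by rewrite !inE => /andP[-> /asboolP/PQ/asboolP].
Qed.

Lemma dense_in_mono (P Q : set G) : P `<=` Q -> dense_in P `<=` dense_in Q.
Proof.
move=> PQ g /le_trans; apply; rewrite ler_nat; exact: translate_count_mono.
Qed.

Lemma dense_in_ex (P : set G) g : dense_in P g -> exists2 a, P a & covers g a.
Proof.
move=> gP; have : (0 < translate_count P g)%N.
  rewrite -(ltr0n R); apply: lt_le_trans gP.
  by rewrite mulr_gt0// ltr0n cardfs_gt0.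
rewrite cardfs_gt0 => /fset0Pn[t]; rewrite !inE => /andP[tT /asboolP tP].
by exists (t * g)%g => //; rewrite covers_mul.
Qed.

Definition separated (C : set G) : Prop :=
  forall c d, C c -> C d -> meets c d -> c = d.

(** Zorn's lemma. The hypothesis makes every translate meet itself, so a [g] in [E] meeting no
    element of [C] lies outside [C] and could be added. *)
Lemma maximal_separated (E : set G) : (forall g, E g -> exists a, covers g a) ->
  exists C, [/\ C `<=` E, separated C &
    forall g, E g -> exists2 c, C c & meets g c].
Proof.
move=> Ecov.
have [F FP totF|C [[CE Csep] Cmax]] :=
    @Zorn_bigcup G (fun C => C `<=` E /\ separated C).
  split=> [g [C /FP[CE _] /CE]//|c d [C FC Cc] [D FD Dd]].
  have [CD|DC] := totF _ _ FC FD.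
    by apply: (FP _ FD).2 => //; apply: CD.
  by apply: (FP _ FC).2 => //; apply: DC.
exists C; split=> // g Eg; apply: contrapT => gC.
have far c : C c -> ~ meets g c by move=> Cc gc; apply: gC; exists c.
have [a ga] := Ecov _ Eg.
have Cg : ~ C g by move=> /far; apply; exists a.
apply: (Cmax (g |` C)).
  by split=> [|/(_ g (or_introl erefl))//] c; right.
split=> [c [->//|/CE//]|c d [->|Cc] [->|Cd]] //.
- by move=> /(far _ Cd).
- by move=> [b cb db]; case: (far _ Cc); exists b.
- exact: Csep.
Qed.

(** One maximal family, chosen once and for all; [centers_inP] shows that the default [set0] is
    harmless. *)
Definition centers_in (P : set G) : set G :=
  xget set0 [set C | [/\ C `<=` dense_in P, separated C &
    forall g, dense_in P g -> exists2 c, C c & meets g c]].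

Lemma centers_inP P : [/\ centers_in P `<=` dense_in P, separated (centers_in P) &
    forall g, dense_in P g -> exists2 c, centers_in P c & meets g c].
Proof.
apply: (@xgetPex _ set0 [set C | [/\ C `<=` dense_in P, separated C &
    forall g, dense_in P g -> exists2 c, C c & meets g c]]).
by apply: maximal_separated => g /dense_in_ex[a _ ga]; exists a.
Qed.

Fixpoint uncovered (j : nat) : set G :=
  if j is i.+1 then
    [set a | uncovered i a /\ forall c, centers_in (uncovered i) c -> ~~ covers c a]
  else setT.

Local Notation centers j := (centers_in (uncovered j)).

Lemma uncoveredP j a : uncovered j a <->
  forall i, (i < j)%N -> forall c, centers i c -> ~~ covers c a.
Proof.
elim: j => [|j IH] /=; first by split.
rewrite IH; split=> [[aj aj'] i|aj].
  by rewrite ltnS leq_eqVlt => /predU1P[->//|]; apply: aj.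
by split=> [i ij|]; apply: aj => //; apply: ltnW.
Qed.

(** A center of a later stage has an uncovered point in its translate, whereas an earlier stage with
    the same center has covered it all. *)
Lemma centers_uniq i j c : centers i c -> centers j c -> i = j.
Proof.
have lt_absurd i' j' : (i' < j')%N -> centers i' c -> centers j' c -> False.
  move=> ij ci cj; have [Cd _ _] := centers_inP (uncovered j').
  have [a /uncoveredP/(_ _ ij _ ci)] := dense_in_ex (Cd _ cj).
  by move=> /negbTE ->.
move=> ci cj; case: (ltngtP i j) => // ij.
- by case: (lt_absurd _ _ ij ci cj).
- by case: (lt_absurd _ _ ij cj ci).
Qed.

(** One more than the number of pairs in [T * T], for the pigeonhole argument in
    [untiled_sparse]. *)
Definition nlevels : nat := (#|` T| ^ 2).+1.

(* [level c = nlevels] means that [c] is not a center. *)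
Definition level (c : G) : nat :=
  find (fun j => `[< centers j c >]) (iota 0 nlevels).

Lemma level_le c : (level c <= nlevels)%N.
Proof. by rewrite -[leqRHS](size_iota 0 nlevels) find_size. Qed.

Lemma levelP c : (level c < nlevels)%N -> centers (level c) c.
Proof.
rewrite -[X in (_ < X)%N](size_iota 0) -has_find => h.
have /asboolP := nth_find 0%N h; rewrite nth_iota ?add0n//.
by rewrite -[X in (_ < X)%N](size_iota 0 nlevels) -has_find.
Qed.

Lemma level_eq j c : (j < nlevels)%N -> centers j c -> level c = j.
Proof.
move=> jn cj; apply: (@centers_uniq _ _ c) => //; apply: levelP.
rewrite -[X in (_ < X)%N](size_iota 0) -has_find; apply/hasP; exists j.
  by rewrite mem_iota.
exact/asboolP.
Qed.

Definition tile (c : G) : bool := (level c < nlevels)%N.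

(** Overlaps go to the earliest stage. The rule only compares levels of centers near [a], so
    ownership is local. *)
Definition owns (c a : G) : Prop := [/\ covers c a, tile c &
  forall d, covers d a -> tile d -> d <> c -> (level c < level d)%N].

Lemma owns_uniq c d a : owns c a -> owns d a -> c = d.
Proof.
move=> [ca tc cmin] [da td dmin]; apply: contrapT => cd.
have := cmin _ da td (fun e => cd (esym e)).
by rewrite ltnNge ltnW// dmin.
Qed.

Lemma owner_exists c a : tile c -> covers c a -> exists d, owns d a.
Proof.
move=> tc ca.
have ex : exists n, `[< exists d, [/\ tile d, covers d a & level d = n] >].
  by exists (level c); apply/asboolP; exists c.
case: (ex_minnP ex) => n /asboolP[d [td da dn]] nmin.
exists d; split=> // e ea te ed; rewrite ltn_neqAle; apply/andP; split.
  apply/eqP => elv; apply: ed.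
  have [_ Csep _] := centers_inP (uncovered (level d)).
  apply: Csep; [by rewrite elv; apply: levelP|exact: levelP|by exists a].
by rewrite dn; apply: nmin; apply/asboolP; exists e.
Qed.

(** The points of [T c] uncovered when [c] is chosen all become its own: no earlier tile covers
    them, and tiles of the same level are disjoint. *)
Lemma tile_owns c : tile c -> delta * #|` T|%:R <= (translate_count (owns c) c)%:R.
Proof.
move=> tc; have cc := levelP tc.
have [Cd Csep _] := centers_inP (uncovered (level c)).
apply: le_trans (Cd _ cc) _; rewrite ler_nat; apply: fsubset_leq_card.
apply/fsubsetP => t; rewrite !inE => /andP[tT /asboolP/uncoveredP unc].
rewrite tT; apply/asboolP; split=> [||d dt td dc]; rewrite ?covers_mul//.
rewrite ltn_neqAle; apply/andP; split.
  apply/eqP => ecd; apply: dc; apply: Csep => //.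
    by rewrite ecd; apply: levelP.
  by exists (t * c)%g => //; rewrite covers_mul.
rewrite leqNgt; apply/negP => /unc/(_ _ (levelP td)).
by rewrite dt.
Qed.

(* A translate that is still dense after all stages meets a center of every
   level; these centers are distinct and lie in [T^-1 T g], too small a set. *)
Lemma untiled_sparse g :
  (translate_count [set a | forall c, tile c -> ~~ covers c a] g)%:R
    < delta * #|` T|%:R.
Proof.
rewrite ltNge; apply/negP => gd.
have {gd} gm : dense_in (uncovered nlevels) g.
  apply: dense_in_mono gd => a aunc; apply/uncoveredP => i im c ci.
  by apply: aunc; rewrite /tile (level_eq im ci).
have ex_c (j : 'I_nlevels) : exists c, centers j c /\ meets g c.
  have [_ _] := centers_inP (uncovered j); move=> /(_ g)[|c cj gc].
    apply: dense_in_mono gm => a /uncoveredP aunc; apply/uncoveredP => i ij.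
    by apply: aunc; apply: ltn_trans ij _.
  by exists c.
have ex_p (j : 'I_nlevels) : exists p : T * T,
    centers j ((fsval p.2)^-1 * (fsval p.1 * g))%g.
  have [c [cj [a ga ca]]] := ex_c j; exists ([` ga]%fset, [` ca]%fset) => /=.
  by rewrite -(mulgA a) mulVg mulg1 invMg invgK -mulgA mulVg mulg1.
have [f fP] := choice ex_p.
have f_inj : injective f.
  move=> i j fij; apply: val_inj; apply: (centers_uniq (fP i)).
  by rewrite fij; apply: fP.
have := leq_card f f_inj.
by rewrite card_ord card_prod -!cardfE mulnn ltnn.
Qed.
End Tiling.

(** * Densities of tiles, untiled points and edges *)

Section TileCounts.
Variables (R : realType) (G : groupType) (T W : {fset G}) (delta : R).
Hypotheses (T0 : T != fset0) (delta0 : 0 < delta).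

Local Notation tile := (tile T delta).
Local Notation owns := (owns T delta).
Local Notation covers := (covers T).
Local Notation Tinv := (fsetinv T).

(** The neighbourhood must lie in the translate [T c], not in the owned part; [inner_neighbour]
    shows that this suffices. *)
Definition inner (c a : G) : Prop :=
  owns c a /\ forall w, w \in W -> covers c (w * a)%g.

Definition gap (a : G) : Prop := ~ exists c, inner c a.

Definition untiled (a : G) : Prop := forall c, tile c -> ~~ covers c a.

Definition edge (a : G) : Prop :=
  exists2 c, owns c a & exists2 w, w \in W & ~~ covers c (w * a)%g.

Let Tpos : 0 < #|` T|%:R :> R.
Proof. by rewrite ltr0n cardfs_gt0. Qed.

(** The owned sets are disjoint, lie in [T Q] when the centers are in [Q], and have at least
    [delta * #|T|] points each. *)
Lemma card_tiles (Q : {fset G}) :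
  delta * #|` T|%:R * #|` [fset c in Q | tile c]%fset|%:R
    <= #|` setmul T Q|%:R.
Proof.
set S := [fset c in Q | tile c]%fset.
apply: (@le_trans _ _ (\sum_(c <- S)
    #|` [fset a in setmul T Q | `[< owns c a >]]%fset|%:R)).
  rewrite [X in _ * X%:R]card_fset_sum1 natr_sum mulr_sumr !big_seq; apply: ler_sum => c.
  rewrite mulr1 !inE => /andP[cQ tc]; apply: le_trans (tile_owns T0 delta0 tc) _.
  rewrite ler_nat; apply: (leq_card_fset (f := fun t => (t * c)%g)).
    by move=> ? ? _ _; apply: mulIg.
  by move=> t; rewrite !inE => /andP[tT ->]; rewrite mem_setmul.
rewrite -natr_sum ler_nat double_count [leqRHS]card_fset_sum1; apply: leq_sum => a _.
rewrite -(cardfs1 tt); apply: (leq_card_fset (f := fun=> tt)) => [c d|c _].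
  rewrite !inE => /andP[_ /asboolP ca] /andP[_ /asboolP da] _.
  exact: owns_uniq ca da.
by rewrite inE.
Qed.

(** Double counting: a point of [Q] lies in [#|T|] translates [T g] with [g] in [T^-1 Q], each with
    fewer than [delta * #|T|] untiled points. *)
Lemma card_untiled (Q : {fset G}) :
  #|` [fset a in Q | `[< untiled a >]]%fset|%:R
    <= delta * #|` setmul Tinv Q|%:R.
Proof.
set U := [fset a in Q | _]%fset.
rewrite -(ler_pM2l Tpos) mulrCA mulrA.
apply: (@le_trans _ _ (\sum_(g <- setmul Tinv Q)
    #|` [fset a in U | covers g a]%fset|%:R)).
  rewrite -natr_sum -double_count natr_sum [X in _ * X%:R]card_fset_sum1 natr_sum mulr_sumr.
  rewrite !big_seq; apply: ler_sum => a; rewrite !inE => /andP[aQ _].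
  rewrite mulr1 ler_nat.
  apply: (leq_card_fset (f := fun t => (t^-1 * a)%g)).
    by move=> ? ? _ _ /mulIg/invg_inj.
  move=> t tT; rewrite !inE mem_setmul ?mem_fsetinv ?invgK//.
  by rewrite /covers invMg invgK mulVKg.
rewrite [X in _ * X%:R]card_fset_sum1 natr_sum mulr_sumr; apply: ler_sum => g _.
rewrite mulr1; apply: le_trans (ltW (untiled_sparse T0 delta0 g)); rewrite ler_nat.
apply: (leq_card_fset (f := fun a => (a * g^-1)%g)).
  by move=> ? ? _ _; apply: mulIg.
move=> a; rewrite !inE => /andP[/andP[_ /asboolP ua] ga].
by apply/andP; split=> //; apply/asboolP; rewrite mulgVK.
Qed.

Definition boundary : {fset G} :=
  [fset t in T | `[< exists2 w, w \in W & (w * t)%g \notin T >]]%fset.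

(** Centered at its owner, an edge point lies in [boundary]. One factor [delta] of the square is
    spent on the density of tiles in [card_tiles]. *)
Lemma card_edge (Q : {fset G}) :
  #|` boundary|%:R <= delta ^+ 2 * #|` T|%:R ->
  #|` [fset a in Q | `[< edge a >]]%fset|%:R
    <= delta * #|` setmul T (setmul Tinv Q)|%:R.
Proof.
move=> bT; set E := [fset a in Q | _]%fset.
pose S := [fset c in setmul Tinv Q | tile c]%fset.
pose r (a c : G) := `[< owns c a >].
apply: (@le_trans _ _ (\sum_(c <- S) #|` [fset a in E | r a c]%fset|%:R)).
  rewrite -natr_sum -double_count ler_nat [leqLHS]card_fset_sum1 !big_seq.
  apply: leq_sum => a; rewrite !inE => /andP[aQ /asboolP[c ca _]].
  rewrite cardfs_gt0; apply/fset0Pn; exists c; rewrite !inE.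
  apply/andP; split; last exact/asboolP.
  have [cov tc _] := ca; rewrite tc andbT.
  apply/setmulP; exists (c * a^-1)%g, a; rewrite mem_fsetinv invMg invgK.
  by rewrite -mulgA mulVg mulg1.
apply: (@le_trans _ _ (\sum_(c <- S) delta ^+ 2 * #|` T|%:R)).
  apply: ler_sum => c _; apply: le_trans bT; rewrite ler_nat.
  apply: (leq_card_fset (f := fun a => (a * c^-1)%g)).
    by move=> ? ? _ _; apply: mulIg.
  move=> a; rewrite !inE.
  move=> /andP[/andP[_ /asboolP[d da [w wW wa]]] /asboolP ca].
  rewrite (owns_uniq da ca) in wa; have [cov _ _] := ca.
  apply/andP; split=> //; apply/asboolP; exists w => //.
  by rewrite mulgA.
apply: le_trans (ler_wpM2l (ltW delta0) (card_tiles (setmul Tinv Q))).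
rewrite -/S [X in _ <= _ * (_ * X%:R)]card_fset_sum1 natr_sum !mulr_sumr.
by apply: ler_sum => c _; rewrite mulr1 mulrA expr2.
Qed.

Lemma card_gap (Q : {fset G}) :
  #|` boundary|%:R <= delta ^+ 2 * #|` T|%:R ->
  #|` [fset a in Q | `[< gap a >]]%fset|%:R
    <= delta * (#|` setmul Tinv Q|%:R + #|` setmul T (setmul Tinv Q)|%:R).
Proof.
move=> bT; rewrite mulrDr.
apply: le_trans (lerD (card_untiled Q) (card_edge _ bT)).
rewrite -natrD ler_nat.
set A := [fset a in Q | `[< untiled a >]]%fset.
set B := [fset a in Q | `[< edge a >]]%fset.
apply: (@leq_trans #|` A `|` B|%fset); last by rewrite cardfsU leq_subr.
apply: fsubset_leq_card; apply/fsubsetP => a; rewrite !inE.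
move=> /andP[-> /asboolP ga] /=; apply/orP.
have [|ta] := pselect (untiled a); first by left; apply/asboolP.
right; apply/asboolP.
have [c tc ca] : exists2 c, tile c & covers c a.
  apply: contrapT => nc; apply: ta => c tc; apply/negP => ca.
  by apply: nc; exists c.
have [d da] := owner_exists T0 delta0 tc ca; exists d => //.
apply: contrapT => nw; apply: ga; exists d; split=> // w wW.
by apply: contrapT => /negP wa; apply: nw; exists w.
Qed.
End TileCounts.

(** * Rewriting the tiles *)

Section Filling.
Variables (R : realType) (G : groupType) (Sigma : finType).
Variables (T V W : {fset G}) (delta : R) (X : set (config G Sigma)).
Variable x : config G Sigma.
Hypotheses (WV : forall u v, u \in V -> v \in V -> (u * v^-1)%g \in W)
  (Winv : forall w, w \in W -> w^-1%g \in W)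
  (Xshift : forall g, Defs.shift g @` X `<=` X) (Xx : X x).

Local Notation tile := (tile T delta).
Local Notation level := (level T delta).
Local Notation owns := (owns T delta).
Local Notation covers := (covers T).
Local Notation inner := (inner T W delta).
Local Notation gap := (gap T W delta).
Local Notation Tinv := (fsetinv T).

Lemma coversM b a g : covers (b * g)%g (a * g)%g = covers b a.
Proof. by rewrite /covers mulgKA. Qed.

Lemma inner_uniq c d a : inner c a -> inner d a -> c = d.
Proof. by move=> [ca _] [da _]; apply: owns_uniq ca da. Qed.

(* If the owners differed, each would have strictly smaller level than the other. *)
Lemma inner_neighbour c d a w :
  w \in W -> inner c a -> inner d (w * a)%g -> c = d.
Proof.
move=> wW [[ca tc cmin] cW] [[da td dmin] dW]; apply: contrapT => cd.
have := dW _ (Winv wW); rewrite mulKg => da'.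
have := cmin _ da' td (fun e => cd (esym e)).
by rewrite ltnNge ltnW// dmin//; apply: cW.
Qed.

(* The input of the filling rule at [c], in coordinates centered at [c]; by
   [inner_neighbour] it only reads symbols at gap points. *)
Definition collar (c w : G) : option Sigma :=
  if `[< ~ inner c (w * c)%g /\ exists2 v, v \in W & inner c (v * (w * c))%g >]
  then Some (x (w * c)%g) else None.

(** The choice depends on [b] and not on the center: tiles with equal collars get equal fillings,
    which makes [refill] locally determined. *)
Definition fill (b : G -> option Sigma) : config G Sigma :=
  xget x [set z | X z /\ forall w s, b w = Some s -> z w = s].

Lemma fill_collar c : X (fill (collar c)) /\
  forall w s, collar c w = Some s -> fill (collar c) w = s.
Proof.
apply: (@xgetPex _ x
  [set z | X z /\ forall w s, collar c w = Some s -> z w = s]).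
(* The original point, recentered at [c], agrees with its own collar. *)
exists (Defs.shift c x); split; first by apply: Xshift; exists x.
by move=> w s; rewrite /collar; case: asboolP => // _ [<-].
Qed.

Definition refill : config G Sigma := fun a =>
  if pselect (exists c, inner c a) is left e
  then fill (collar (projT1 (cid e))) (a * (projT1 (cid e))^-1)%g else x a.

Lemma refill_inner c a : inner c a -> refill a = fill (collar c) (a * c^-1)%g.
Proof.
move=> ca; rewrite /refill; case: pselect => [e|]; last by case; exists c.
by case: (cid e) => d /= da; rewrite (inner_uniq da ca).
Qed.

Lemma refill_gap a : gap a -> refill a = x a.
Proof. by move=> ga; rewrite /refill; case: pselect. Qed.

(** The inner points of a window belong to a single tile, and its gap points then lie in the collar
    of that tile; so the window shows a translated filling, or [x] if it has no inner point. *)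
Lemma refill_window g :
  exists2 z, X z & forall v, v \in V -> refill (v * g)%g = z (v * g)%g.
Proof.
have [[v [c [vV vc]]]|no] :=
    pselect (exists v c, v \in V /\ inner c (v * g)%g); last first.
  exists x => // v vV; apply: refill_gap => -[c vc].
  by apply: no; exists v, c.
have [Xf fE] := fill_collar c.
exists (Defs.shift c^-1%g (fill (collar c))).
  by apply: (Xshift (g := c^-1%g)); exists (fill (collar c)).
move=> u uV; rewrite /Defs.shift.
have uvg : (u * g = u * v^-1 * (v * g))%g by rewrite mulgA mulgVK.
have [[d ud]|gu] := pselect (exists d, inner d (u * g)%g).
  rewrite (refill_inner ud).
  by rewrite uvg in ud *; rewrite (inner_neighbour (WV uV vV) vc ud).
rewrite (refill_gap gu); apply/esym/fE; rewrite /collar mulgVK.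
rewrite asboolT//; split; first by move=> uc; apply: gu; exists c.
exists (v * u^-1)%g; first exact: WV.
by rewrite mulgA mulgVK.
Qed.

Definition gap_symbol (a : G) : option Sigma :=
  if `[< gap a >] then Some (refill a) else None.

Lemma inner_translate c a g h :
  (forall b, covers b a -> level (b * g)%g = level (b * h)%g) ->
  inner (c * g)%g (a * g)%g -> inner (c * h)%g (a * h)%g.
Proof.
move=> lgh [[]]; rewrite !coversM => ca tc cmin cW; split; last first.
  by move=> w /cW; rewrite !mulgA !coversM.
rewrite /tile (lgh _ ca) in tc.
split; rewrite ?coversM// => d da td dc.
have hK : (d * h^-1 * h = d)%g by rewrite mulgVK.
rewrite -hK in da td dc *; rewrite coversM in da.
rewrite -!lgh//; apply: cmin; rewrite ?coversM//.
  by rewrite /tile lgh.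
by move=> /mulIg e; apply: dc; rewrite e.
Qed.

(** Gap symbols tell whether the point is a gap point and, if so, its symbol. Otherwise it is inner
    to a tile [c]; levels on [T^-1 T T^-1 k] fix the inner points of [c], and gap symbols on
    [W T T^-1 k] fix its collar, hence its filling. *)
Lemma refill_local (U : {fset G}) k g h :
  1%g \in U ->
  {subset setmul Tinv (setmul T Tinv) <= U} ->
  {subset setmul W (setmul T Tinv) <= U} ->
  (forall u, u \in U -> level (u * k * g)%g = level (u * k * h)%g) ->
  (forall u, u \in U -> gap_symbol (u * k * g)%g = gap_symbol (u * k * h)%g) ->
  refill (k * g)%g = refill (k * h)%g.
Proof.
move=> U1 UN UM lgh sgh.
have := sgh _ U1; rewrite mul1g /gap_symbol.
case: asboolP => [_|ng]; case: asboolP => // nh; first by case.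
move=> _; have {ng} [c0 kc0] : exists c, inner c (k * g)%g by apply: contrapT.
have c0g : (c0 * g^-1 * g)%g = c0 by rewrite mulgVK.
move: (c0 * g^-1)%g c0g => c c0g; rewrite -{}c0g {c0} in kc0.
have kc : covers c k by case: kc0 => -[]; rewrite coversM.
have ldc a b : covers c a -> covers b a -> level (b * g)%g = level (b * h)%g.
  move=> ca ba.
  have -> : (b = (a * b^-1)^-1 * ((a * c^-1) * (k * c^-1)^-1) * k)%g.
    by rewrite !invgF !mulgA !mulgVK.
  rewrite lgh//; apply: UN; rewrite mem_setmul ?mem_fsetinv ?invgK//.
  by rewrite mem_setmul ?mem_fsetinv ?invgK.
have inn a : inner (c * g)%g (a * g)%g <-> inner (c * h)%g (a * h)%g.
  split=> ca.
    have ca' : covers c a by case: ca => -[]; rewrite coversM.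
    by apply: inner_translate ca => b; apply: ldc.
  have ca' : covers c a by case: ca => -[]; rewrite coversM.
  by apply: inner_translate ca => b ba; rewrite (ldc a).
rewrite (refill_inner kc0) (refill_inner (iffLR (inn _) kc0)) !mulgKA.
congr (fill _ _); apply/funext => w; rewrite /collar !mulgA.
set P := ~ _ /\ _; set Q := ~ _ /\ _.
have PQ : P <-> Q.
  rewrite /P /Q inn; split=> -[nw [v vW vw]]; split=> //; exists v => //.
    by move: vw; rewrite !mulgA inn.
  by move: vw; rewrite !mulgA inn.
rewrite (propext PQ); case: asboolP => // Qw; congr Some.
have [nwg [v vW vwg]] := PQ.2 Qw; have [nwh [v' v'W vwh]] := Qw.
(* An inner point here would share the tile of its neighbour. So the collar reads gap points only,
   where [refill] and [x] agree. *)
have gg : gap (w * c * g)%g.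
  by move=> [d wd]; apply: nwg; rewrite -(inner_neighbour vW wd vwg).
have gh : gap (w * c * h)%g.
  by move=> [d wd]; apply: nwh; rewrite -(inner_neighbour v'W wd vwh).
have vc : covers c (v * w * c)%g.
  by case: vwg => -[]; rewrite !mulgA coversM.
have wck : (w * c = v^-1 * ((v * w * c * c^-1) * (k * c^-1)^-1) * k)%g.
  by rewrite invgF mulgK !mulgA mulVg mul1g mulgVK.
have : gap_symbol (w * c * g)%g = gap_symbol (w * c * h)%g.
  rewrite wck sgh//; apply: UM; rewrite mem_setmul ?Winv//.
  by rewrite mem_setmul ?mem_fsetinv ?invgK.
by rewrite /gap_symbol !asboolT// !refill_gap// => -[].
Qed.
End Filling.

(** * Subshifts of finite type *)

Section SFT.
Variables (G : groupType) (Sigma : finType).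
Implicit Types (x y : config G Sigma) (X C : set (config G Sigma)).

Lemma shiftM g h x : Defs.shift g (Defs.shift h x) = Defs.shift (g * h)%g x.
Proof. by apply/funext => k; rewrite /Defs.shift mulgA. Qed.

Lemma shift1 x : Defs.shift 1%g x = x.
Proof. by apply/funext => k; rewrite /Defs.shift mulg1. Qed.

Lemma shift_imageP g C x : (Defs.shift g @` C) x <-> C (Defs.shift g^-1%g x).
Proof.
split=> [[y Cy <-]|Cx]; first by rewrite shiftM mulVg shift1.
by eexists; first exact: Cx; rewrite shiftM mulgV shift1.
Qed.

Lemma open_shift_cylinder g (p : pattern G Sigma) :
  open (Defs.shift g @` cylinder p).
Proof.
rewrite openE => x /shift_imageP xp; rewrite /interior.
have near_x (h : domf p) :
    \forall y \near x, y (val h * g^-1)%g = x (val h * g^-1)%g.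
  apply: (@proj_continuous _ (fun _ : G => discrete_topology Sigma)
    (val h * g^-1)%g x [set s | s = x (val h * g^-1)%g]).
  exact: discrete_set1.
apply: filterS (filter_forall _ near_x) => y xy.
apply/shift_imageP; rewrite /cylinder /= -xp; apply/ffunP => h.
by rewrite !ffunE; apply: xy.
Qed.

Lemma is_SFT_avoid (P : set (pattern G Sigma)) : finite_set P ->
  is_SFT (~` \bigcup_(p in P) \bigcup_(g in [set: G]) (Defs.shift g @` cylinder p)).
Proof.
move=> finP; split; last by exists P.
split.
  apply: open_closedC; apply: bigcup_open => p _; apply: bigcup_open => g _.
  exact: open_shift_cylinder.
move=> g _ [x xP <-] [p Pp [h _ /shift_imageP hx]]; apply: xP.
exists p => //; exists (g^-1 * h)%g => //; apply/shift_imageP.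
by rewrite invMg invgK -shiftM.
Qed.

(** [V] is the union of the domains of the forbidden patterns: one occurring in [y] would occur in
    [z] at the same place. *)
Lemma sft_window X : is_SFT X -> exists V : {fset G}, forall y,
  (forall g, exists2 z, X z & forall v, v \in V -> y (v * g)%g = z (v * g)%g) ->
  X y.
Proof.
move=> [_ [P finP XE]]; exists (\bigcup_(p <- fset_set P) domf p)%fset => y yloc.
rewrite XE => -[p Pp [g _ /shift_imageP yp]].
have [z] := yloc g^-1%g; rewrite {1}XE => zP yz; apply: zP.
exists p => //; exists g => //; apply/shift_imageP.
rewrite /cylinder /= -yp; apply/ffunP => h; rewrite !ffunE /Defs.shift yz//.
apply/bigfcupP; exists p; last exact: fsvalP.
by rewrite andbT in_fset_set// inE.
Qed.

Definition with_patterns X (K : {fset G}) (L : {set {ffun K -> Sigma}}) :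
    set (config G Sigma) :=
  [set x | X x /\ forall g, restrict_to K (Defs.shift g x) \in L].

Lemma is_SFT_with_patterns X (K : {fset G}) (L : {set {ffun K -> Sigma}}) :
  is_SFT X -> is_SFT (with_patterns X L).
Proof.
move=> [_ [P finP XE]].
pose N : set (pattern G Sigma) := [set FinMap p | p in [set p | p \notin L]].
have finN : finite_set N by apply: finite_image; apply: finite_finset.
suff -> : with_patterns X L = ~` \bigcup_(p in P `|` N)
    \bigcup_(g in [set: G]) (Defs.shift g @` cylinder p).
  by apply: is_SFT_avoid; rewrite finite_setU.
rewrite bigcup_setU setCU -XE; apply/seteqP; split=> x [Xx xL]; split=> //.
  move=> [_ [p /negP pL <-] [g _ /shift_imageP xp]].
  by apply: pL; rewrite -[p]xp.
move=> g; apply: contrapT => /negP gx; apply: xL.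
exists (FinMap (restrict_to K (Defs.shift g x))); first by exists (restrict_to K (Defs.shift g x)).
by exists g^-1%g => //; apply/shift_imageP; rewrite invgK.
Qed.
End SFT.

Lemma small_support_gt0 (D L : finType) (N : nat) : (0 < #|small_support D L N|)%N.
Proof.
apply/card_gt0P; exists [ffun=> None]; rewrite inE.
by rewrite eq_card0// => d; rewrite inE ffunE eqxx.
Qed.

Lemma leq_card_set_fset (A : finType) (B : choiceType) (f : A -> B)
    (P : {set A}) (S : {fset B}) :
  injective f -> (forall a, a \in P -> f a \in S) -> (#|P| <= #|` S|)%N.
Proof.
move=> f_inj fS; rewrite cardE -(size_map f); apply: uniq_leq_size.
  by rewrite map_inj_uniq// enum_uniq.
by move=> b /mapP[x]; rewrite mem_enum => xP ->; apply: fS.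
Qed.

(** * A point with few patterns *)

Section SetMul.
Variable G : groupType.
Implicit Types A B C : {fset G}.

Lemma setmulA A B C : setmul A (setmul B C) = setmul (setmul A B) C.
Proof.
apply/fsetP => g; apply/setmulP/setmulP.
  move=> [a [_ [aA /setmulP[b [c [bB cC ->]]] ->]]].
  by exists (a * b)%g, c; rewrite mulgA; split=> //; apply: mem_setmul.
move=> [_ [c [/setmulP[a [b [aA bB ->]]] cC ->]]].
by exists a, (b * c)%g; rewrite mulgA; split=> //; apply: mem_setmul.
Qed.

Lemma card_setmulSl A B C : {subset A <= B} ->
  (#|` setmul A C| <= #|` setmul B C|)%N.
Proof.
move=> AB; apply: fsubset_leq_card; apply/fsubsetP => _ /setmulP[a [c [aA cC ->]]].
by apply: mem_setmul => //; apply: AB.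
Qed.
End SetMul.

(** * Growth and boundaries of Folner sets *)

Section Folner.
Variables (R : realType) (G : groupType) (F : nat -> {fset G}).
Hypothesis folF : folner R F.

Lemma folner_symdiff (K : {fset G}) (e : R) : K != fset0 -> 0 < e ->
  \forall n \near \oo,
    #|` symdiff (setmul K (F n)) (F n)|%:R <= e * #|` F n|%:R.
Proof.
move=> K0 e0; have [Fn0 /(_ K K0) /cvgrPdist_le/(_ e e0)] := folF.
apply: filterS => n; rewrite sub0r normrN ger0_norm ?divr_ge0// ler_pdivrMr//.
by rewrite ltr0n cardfs_gt0.
Qed.

Lemma folner_card_setmul (K : {fset G}) : K != fset0 ->
  \forall n \near \oo, (#|` setmul K (F n)| <= 2 * #|` F n|)%N.
Proof.
move=> K0; apply: filterS (folner_symdiff K0 ltr01) => n.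
rewrite mul1r ler_nat => h; apply: leq_trans (card_setmul_le _ _) _.
by rewrite mul2n -addnn leq_add2l.
Qed.

(** For [K] with more than [2 * n0] elements, [K f] already makes [setmul K (F n)] that large, while
    it has at most [2 * #|F n|] elements. *)
Lemma folner_card_gt (n0 : nat) : infinite_set [set: G] ->
  \forall n \near \oo, (n0 <= #|` F n|)%N.
Proof.
move=> infG; have [K _ cK] := infinite_set_fset (2 * n0).+1 infG.
have K0 : K != fset0 by rewrite -cardfs_gt0; apply: leq_trans cK.
apply: filterS (folner_card_setmul K0) => n h.
have /fset0Pn[f fF] := folF.1 n.
rewrite -(leq_pmul2l (ltn0Sn 1)); apply: leq_trans h; apply: leq_trans (ltnW cK) _.
apply: (leq_card_fset (f := fun k => (k * f)%g)) => [k l _ _|k kK].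
  exact: mulIg.
exact: mem_setmul.
Qed.

(** Some [w] moves a boundary point into [W T] minus [T], and each [w] does so injectively. *)
Lemma card_boundary (T W : {fset G}) :
  (#|` boundary T W| <= #|` W| * #|` symdiff (setmul W T) T|)%N.
Proof.
apply: (@leq_trans (\sum_(w <- W)
    #|` [fset t in boundary T W | (w * t)%g \notin T]%fset|)%N).
  rewrite (double_count W (boundary T W) (fun w t => (w * t)%g \notin T)).
  rewrite [leqLHS]card_fset_sum1 !big_seq; apply: leq_sum => t.
  rewrite !inE => /andP[tT /asboolP[w wW wt]].
  by rewrite cardfs_gt0; apply/fset0Pn; exists w; rewrite !inE wW.
rewrite [#|` W|]card_fset_sum1 big_distrl /= !big_seq; apply: leq_sum => w wW.
rewrite mul1n; apply: (leq_card_fset (f := fun t => (w * t)%g)).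
  by move=> s t _ _; apply: mulgI.
by move=> t; rewrite !inE => /andP[/andP[tT _] ->]; rewrite mem_setmul.
Qed.

Lemma folner_boundary (W : {fset G}) (e : R) : W != fset0 -> 0 < e ->
  \forall n \near \oo, #|` boundary (F n) W|%:R <= e * #|` F n|%:R.
Proof.
move=> W0 e0; have cW : 0 < #|` W|%:R :> R by rewrite ltr0n cardfs_gt0.
apply: filterS (folner_symdiff W0 (divr_gt0 e0 cW)) => n h.
have := card_boundary (F n) W; rewrite -(ler_nat R) => /le_trans; apply.
rewrite natrM mulrC -ler_pdivlMr//; apply: le_trans h _.
by rewrite mulrAC.
Qed.
End Folner.

(** * Coding the orbit of the refilled point by levels and gap symbols *)

Section OrbitPatterns.
Variables (R : realType) (G : groupType) (Sigma : finType).
Variables (T W U K : {fset G}) (delta : R) (X : set (config G Sigma)).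
Variable x : config G Sigma.
Hypotheses (Winv : forall w, w \in W -> w^-1%g \in W)
  (U1 : 1%g \in U)
  (UN : {subset setmul (fsetinv T) (setmul T (fsetinv T)) <= U})
  (UM : {subset setmul W (setmul T (fsetinv T)) <= U}).

Local Notation level := (level T delta).
Local Notation y := (refill T W delta X x).
Local Notation m := (nlevels T).

Definition orbit_of (z : config G Sigma) : set (config G Sigma) :=
  [set Defs.shift g z | g in [set: G]].

Lemma card_orbit_patterns (n1 n2 : nat) (z1 z2 : R) :
  (forall g, #|` [fset c in setmul (setmul U K) [fset g] | tile T delta c]%fset|
     <= n1)%N ->
  (forall g, #|` [fset a in setmul (setmul U K) [fset g]
     | `[< gap T W delta a >]]%fset| <= n2)%N ->
  1 <= z1 -> 1 <= z2 ->
  ln #|patterns K (orbit_of y)|%:R <=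
    n1%:R * ln z1 + #|` setmul U K|%:R * (m%:R / z1)
    + (n2%:R * ln z2 + #|` setmul U K|%:R * (#|Sigma|%:R / z2)).
Proof.
move=> tile_n gap_n z1_ge1 z2_ge1.
set D := setmul U K.
(* [insub] sends the level [m] of non-centers to [None], so the support of the first component is
   the set of tiles. *)
pose dat (g : G) : {ffun D -> option 'I_m} * {ffun D -> option Sigma} :=
  ([ffun u : D => insub (level (val u * g)%g)],
   [ffun u : D => gap_symbol T W delta X x (val u * g)%g]).
pose pos (z : config G Sigma) := xget 1%g [set g | z = Defs.shift g y].
have posP z : orbit_of y z -> z = Defs.shift (pos z) y.
  move=> [g _ gz]; apply: (@xgetPex _ 1%g [set g | z = Defs.shift g y]).
  by exists g.
have mul_inj (g : G) : injective (fun u : D => (val u * g)%g).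
  by move=> u v /mulIg/val_inj.
have mem_mul (u : D) (g : G) : (val u * g)%g \in setmul D [fset g]%fset.
  by apply: mem_setmul; [apply: valP|rewrite inE].
have card_le : (#|patterns K (orbit_of y)|
    <= #|finset.setX (small_support D 'I_m n1) (small_support D Sigma n2)|)%N.
  apply: (@card_patterns_le _ _ _ _ _ _ (fun z => dat (pos z))).
    move=> z _; rewrite inE /= !inE; apply/andP; split.
      apply: leq_trans (tile_n (pos z)); apply: (leq_card_set_fset (@mul_inj (pos z))).
      move=> u; rewrite inE ffunE; case: insubP => // _ lt_m _ _.
      by rewrite !inE mem_mul.
    apply: leq_trans (gap_n (pos z)); apply: (leq_card_set_fset (@mul_inj (pos z))).
    move=> u; rewrite inE ffunE /gap_symbol; case: asboolP => // ga _.
    by rewrite !inE mem_mul; apply/asboolP.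
  move=> z z' zO z'O [/ffunP lev /ffunP sym] k kK.
  rewrite (posP _ zO) (posP _ z'O) /Defs.shift; apply: (refill_local Winv U1 UN UM) => u uU.
    have := lev [` mem_setmul uU kK]%fset; rewrite !ffunE /=.
    have lev_le := level_le T delta.
    case: insubP => [i ilt iE|nlt]; case: insubP => [j jlt jE|nlt'] //.
      by move=> [ij]; rewrite -iE -jE ij.
    (* Two values [None] mean that both levels are at least [m], hence equal to [m]. *)
    move=> _; apply/eqP; rewrite eqn_leq.
    move: nlt nlt'; rewrite -!leqNgt => h h'.
    by rewrite (leq_trans (lev_le _) h') (leq_trans (lev_le _) h).
  by have := sym [` mem_setmul uU kK]%fset; rewrite !ffunE.
apply: (@le_trans _ _ (ln (#|small_support D 'I_m n1|%:R
    * #|small_support D Sigma n2|%:R))).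
  rewrite ler_ln ?posrE ?mulr_gt0 ?ltr0n ?small_support_gt0//.
    by rewrite -natrM ler_nat -cardsX.
  by apply: card_patterns_gt0; exists y, 1%g => //; rewrite shift1.
rewrite lnM ?posrE ?ltr0n ?small_support_gt0// cardfE.
apply: lerD; last exact: card_small_support.
by rewrite -[X in X%:R / _]card_ord; apply: card_small_support.
Qed.
End OrbitPatterns.

(** * Choice of the parameters *)

Lemma gap_parameter (R : realType) (s : nat) (eps : R) : 0 < eps ->
  exists z delta : R, [/\ 1 <= z, 0 < delta, 2 * (s%:R / z) <= eps / 4 &
    4 * delta * ln z <= eps / 4].
Proof.
move=> eps0; pose z : R := 1 + 8 * s%:R / eps.
have z1 : 1 <= z by rewrite lerDl divr_ge0 ?mulr_ge0// ltW.
have lz : 0 <= ln z by rewrite ln_ge0.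
have lz1 : 0 < 1 + ln z by rewrite ltr_pwDl.
(* [z] is fixed first, against the number of symbols; [delta] is then small compared with [ln z]. *)
exists z, (eps / 16 / (1 + ln z)); split=> //.
- by rewrite !divr_gt0.
- rewrite mulrA ler_pdivrMr; last exact: lt_le_trans z1.
  rewrite (_ : eps / 4 * z = eps / 4 + 2 * s%:R); first by rewrite lerDr divr_ge0 ?ltW.
  by rewrite /z; field; rewrite gt_eqF.
- rewrite (_ : _ * _ = eps / 4 * (ln z / (1 + ln z))).
    have : ln z / (1 + ln z) <= 1 by rewrite ler_pdivrMr// mul1r lerDr.
    by move=> h; rewrite ler_piMr// divr_ge0// ltW.
  by field; rewrite gt_eqF.
Qed.

(** Here [t] stands for [#|T|]. The weight [t ^ 3] beats the [t ^ 2 + 1] levels, while its logarithm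
    is negligible against [t]. *)
Lemma tile_parameter (R : realType) (delta eps : R) : 0 < delta -> 0 < eps ->
  exists n0 : nat, forall t, (n0 <= t)%N ->
    [/\ 1 <= t%:R ^+ 3 :> R, 2 * ((t ^ 2).+1%:R / t%:R ^+ 3) <= eps / 4 &
      2 / (delta * t%:R) * ln (t%:R ^+ 3) <= eps / 4].
Proof.
(* With [ln t] at most twice the square root of [t], the last bound holds once that root reaches
   [q]; [16 / eps] serves the second bound. *)
move=> delta0 eps0; pose q := 48 / (delta * eps); have q0 : 0 < q.
  by rewrite divr_gt0// mulr_gt0.
exists (Num.truncn (1 + 16 / eps + q ^+ 2)).+1 => t tn.
have := truncnS_gt (1 + 16 / eps + q ^+ 2).
have : (Num.truncn (1 + 16 / eps + q ^+ 2)).+1%:R <= t%:R :> R by rewrite ler_nat.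
move: (_.+1%:R) => b bt ltb; have tq := lt_le_trans ltb bt.
have e0 : 0 < 16 / eps by rewrite divr_gt0.
have q20 : 0 <= q ^+ 2 by rewrite exprn_ge0// ltW.
set r : R := t%:R in tq *.
have r1 : 1 <= r by lra.
have r0 : 0 < r by apply: lt_le_trans r1.
have re : 16 <= eps * r by rewrite mulrC -ler_pdivrMr//; lra.
have sr0 : 0 < Num.sqrt r by rewrite sqrtr_gt0.
have srr : Num.sqrt r * Num.sqrt r = r by rewrite -expr2 sqr_sqrtr// ltW.
have qr : q <= Num.sqrt r.
  rewrite -(@ler_pXn2r _ 2)// ?nnegrE ?sqrtr_ge0 ?(ltW q0)//.
  by rewrite sqr_sqrtr ?ltW//; lra.
have lnr : ln r <= 2 * Num.sqrt r.
  rewrite -{1}srr -expr2 lnXn// -[leLHS]mulr_natl ler_pM2l//.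
  exact/ltW/ln_sublinear.
split.
- exact: exprn_ege1.
- rewrite mulrA ler_pdivrMr ?exprn_gt0// -[(t ^ 2).+1%:R]natr1 natrX -/r.
  have : 4 * r ^+ 2 <= eps / 4 * r ^+ 3.
    rewrite (_ : eps / 4 * r ^+ 3 = (eps * r) / 4 * r ^+ 2); last by field.
    by rewrite ler_pM2r ?exprn_gt0//; lra.
  have : 1 <= r ^+ 2 by exact: exprn_ege1.
  lra.
- rewrite lnXn// -[ln r *+ 3]mulr_natl.
  rewrite (_ : 2 / _ * _ = 6 * ln r / (delta * r)); last first.
    by field; rewrite !gt_eqF.
  rewrite ler_pdivrMr ?mulr_gt0//.
  apply: (@le_trans _ _ (12 * Num.sqrt r)); first lra.
  rewrite -{2}srr !mulrA ler_pM2r//.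
  move: qr; rewrite /q ler_pdivrMr ?mulr_gt0// => qr; lra.
Qed.

Lemma low_entropy_orbit (R : realType) (G : groupType) (Sigma : finType)
    (X : set (config G Sigma)) (eps : R) :
  infinite_set [set: G] -> amenable R G -> is_SFT X -> X !=set0 -> 0 < eps ->
  exists (y : config G Sigma) (K : {fset G}), [/\ X y, K != fset0 &
    ln #|patterns K (orbit_of y)|%:R <= eps * #|` K|%:R].
Proof.
move=> infG [F folF] sftX [x Xx] eps0.
have Xshift : forall g, Defs.shift g @` X `<=` X by case: sftX => -[].
have [V Vwin] := sft_window sftX.
pose W : {fset G} := (1%g |` setmul V (fsetinv V))%fset.
have WV u v : u \in V -> v \in V -> (u * v^-1)%g \in W.
  by move=> uV vV; rewrite !inE mem_setmul ?orbT// mem_fsetinv invgK.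
have Winv w : w \in W -> w^-1%g \in W.
  rewrite !inE => /orP[/eqP ->|/setmulP[u [v [uV]]]]; first by rewrite invg1 eqxx.
  rewrite mem_fsetinv => vV ->.
  by rewrite invMg mem_setmul ?orbT// mem_fsetinv invgK.
have W0 : W != fset0 by apply/fset0Pn; exists 1%g; rewrite !inE eqxx.
have [z2 [delta [z2_ge1 delta0 z2e delta_e]]] := gap_parameter #|Sigma| eps0.
have [n0 n0P] := tile_parameter delta0 eps0.
have [T [T0 bT /n0P[z1_ge1 z1e t_e]]] : exists T : {fset G}, [/\ T != fset0,
    #|` boundary T W|%:R <= delta ^+ 2 * #|` T|%:R & (n0 <= #|` T|)%N].
  have [n [bn cn]] := filter_ex (filterI
    (folner_boundary folF W0 (exprn_gt0 2 delta0)) (folner_card_gt folF n0 infG)).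
  by exists (F n); split=> //; apply: folF.1.
set z1 : R := _ ^+ 3 in z1_ge1 z1e t_e.
pose N := setmul (fsetinv T) (setmul T (fsetinv T)).
pose M := setmul W (setmul T (fsetinv T)).
pose U : {fset G} := (1%g |` (N `|` M))%fset.
(* These are the left factors of [K] in the window and in the bounds of [card_tiles] and [card_gap];
   one Folner estimate handles all four. *)
pose U' : {fset G} := (U `|` (setmul T U `|` (setmul (fsetinv T) U `|`
  setmul T (setmul (fsetinv T) U))))%fset.
have U1 : 1%g \in U by rewrite !inE eqxx.
have U'0 : U' != fset0 by apply/fset0Pn; exists 1%g; rewrite inE U1.
have [n nU] := filter_ex (folner_card_setmul folF U'0).
move: (F n) (folF.1 n) nU => K K0 cK.
have sub (A : {fset G}) : {subset A <= U'} ->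
    #|` setmul A K|%:R <= 2 * #|` K|%:R :> R.
  by move=> AU; rewrite -natrM ler_nat; apply: leq_trans cK; apply: card_setmulSl.
have UK : #|` setmul U K|%:R <= 2 * #|` K|%:R :> R.
  by apply: sub => u uU; rewrite inE uU.
have translate (A B : {fset G}) g : setmul A (setmul (setmul B K) [fset g]%fset)
    = setmul (setmul (setmul A B) K) [fset g]%fset by rewrite !setmulA.
have k0 : 0 < #|` K|%:R :> R by rewrite ltr0n cardfs_gt0.
have t0 : 0 < #|` T|%:R :> R by rewrite ltr0n cardfs_gt0.
(* The bounds of [card_tiles] and [card_gap] on [U K g], where each product set has at most
   [2 * #|K|] elements. *)
pose n1 := Num.truncn (2 * #|` K|%:R / (delta * #|` T|%:R) : R).
pose n2 := Num.truncn (4 * delta * #|` K|%:R : R).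
have n1_le : n1%:R <= 2 * #|` K|%:R / (delta * #|` T|%:R).
  by rewrite truncn_le// divr_ge0 ?mulr_ge0// ltW.
have n2_le : n2%:R <= 4 * delta * #|` K|%:R.
  by rewrite truncn_le// !mulr_ge0// ltW.
exists (refill T W delta X x), K; split=> //.
  by apply: Vwin; apply: refill_window.
have UN : {subset N <= U} by move=> u uN; rewrite !inE uN orbT.
have UM : {subset M <= U} by move=> u uM; rewrite !inE uM !orbT.
have tiles_n1 g :
    (#|` [fset c in setmul (setmul U K) [fset g] | tile T delta c]%fset| <= n1)%N.
  rewrite truncn_ge_nat; last by rewrite divr_ge0 ?mulr_ge0// ltW.
  rewrite ler_pdivlMr ?mulr_gt0// mulrC.
  apply: le_trans (card_tiles T0 delta0 _) _.
  rewrite translate card_setmul1r; apply: sub => u uTU.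
  by rewrite !inE uTU !orbT.
have gaps_n2 g : (#|` [fset a in setmul (setmul U K) [fset g]
    | `[< gap T W delta a >]]%fset| <= n2)%N.
  rewrite truncn_ge_nat; last by rewrite !mulr_ge0// ltW.
  apply: le_trans (card_gap T0 delta0 _ bT) _.
  rewrite (_ : 4 * delta * _ = delta * (2 * #|` K|%:R + 2 * #|` K|%:R)); last by ring.
  rewrite ler_pM2l// lerD//.
    rewrite translate card_setmul1r; apply: sub => u uTU.
    by rewrite !inE uTU !orbT.
  rewrite translate translate card_setmul1r; apply: sub => u uTU.
  by rewrite !inE uTU !orbT.
apply: le_trans (card_orbit_patterns X x Winv U1 UN UM tiles_n1 gaps_n2 z1_ge1 z2_ge1) _.
have e1 : n1%:R * ln z1 <= eps / 4 * #|` K|%:R.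
  apply: le_trans (ler_wpM2r (ln_ge0 z1_ge1) n1_le) _.
  rewrite [2 * _ / _]mulrAC -[leLHS]mulrA [_ * ln z1]mulrC mulrA.
  by rewrite ler_pM2r.
have e2 : n2%:R * ln z2 <= eps / 4 * #|` K|%:R.
  apply: le_trans (ler_wpM2r (ln_ge0 z2_ge1) n2_le) _.
  by rewrite mulrAC ler_pM2r.
have e3 : #|` setmul U K|%:R * ((nlevels T)%:R / z1) <= eps / 4 * #|` K|%:R.
  apply: (@le_trans _ _ (2 * #|` K|%:R * ((nlevels T)%:R / z1))).
    by rewrite ler_wpM2r// divr_ge0// (le_trans _ z1_ge1).
  by rewrite mulrAC ler_pM2r.
have e4 : #|` setmul U K|%:R * (#|Sigma|%:R / z2) <= eps / 4 * #|` K|%:R.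
  apply: (@le_trans _ _ (2 * #|` K|%:R * (#|Sigma|%:R / z2))).
    by rewrite ler_wpM2r// divr_ge0// (le_trans _ z2_ge1).
  by rewrite mulrAC ler_pM2r.
lra.
Qed.

Theorem theorem3p17 (R : realType) (G : groupType) (Sigma : finType)
    (hGcountable : countable [set: G]) (hGinfinite : infinite_set [set: G])
    (hGamenable : amenable R G)
    (X : set (config G Sigma)) (hX : is_SFT X) (hX0 : X !=set0)
    (eps : R) (heps : 0 < eps) :
  exists Z : set (config G Sigma),
    [/\ is_SFT Z, Z !=set0, Z `<=` X & exists2 h : R, is_htop Z h & h <= eps].
Proof.
have [y [K [Xy K0 yK]]] := low_entropy_orbit hGinfinite hGamenable hX hX0 heps.
pose Z := with_patterns X (patterns K (orbit_of y)).
have sftZ : is_SFT Z by apply: is_SFT_with_patterns.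
have Zy : Z y.
  split=> // g; apply/patternsP; exists (Defs.shift g y) => //.
  by exists g.
have Z0 : Z !=set0 by exists y.
exists Z; split=> //; first by move=> x [].
have [h Zh hK] := infimum_rule R sftZ.1.2 Z0 K0.
exists h => //; apply: le_trans hK _.
rewrite ler_pdivrMr ?ltr0n ?cardfs_gt0//; apply: le_trans yK.
rewrite ler_ln ?posrE ?ltr0n ?card_patterns_gt0//; last first.
  by exists y, 1%g => //; rewrite shift1.
rewrite ler_nat; apply: subset_leq_card; apply/fintype.subsetP => p.
by move=> /patternsP[z [_ /(_ 1%g)]]; rewrite shift1 => zK <-.
Qed.
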